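(* Let $I=[a,b]\subset\mathbb{R}$, let $\varphi:I\to I$, and let $f:I\to[0,\infty)$ be a $\varphi$-$P$-function. Let $t_1,\dots,t_n\in(0,1)$ with $\sum_{i=1}^n t_i=1$, and let $x_1,\dots,x_n\in I$. Then $$f\left(\sum_{i=1}^n t_i\varphi(x_i)\right)\le\sum_{i=1}^n f(\varphi(x_i)).$$
   Context: A function $f:I\to[0,\infty)$ is a $\varphi$-$P$-function (also called $\varphi$-$P$-convex) if $f(t\varphi(x)+(1-t)\varphi(y))\le f(\varphi(x))+f(\varphi(y))$ for all $x,y\in I$ and $t\in(0,1)$. *)

(* Defs.v *)
From mathcomp Require Import all_boot all_order all_algebra.
From mathcomp Require Import reals.
Set Implicit Arguments.
Unset Strict Implicit.
Unset Printing Implicit Defensive.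
Import Order.TTheory GRing.Theory Num.Theory.
Local Open Scope ring_scope.

(* Maps on the interval I are represented by functions R -> R of which only   *)
(* the values on I matter; the typings phi : I -> I and f : I -> [0, +oo) are  *)
(* hypotheses to be stated where the definition is used. Since I is convex,   *)
(* they ensure that f is evaluated only at points of I below.                 *)
Definition phi_P_function (R : realType) (I : interval R) (phi f : R -> R) :
    Prop :=
  forall x y t : R, x \in I -> y \in I -> 0 < t < 1 ->
    f (t * phi x + (1 - t) * phi y) <= f (phi x) + f (phi y).

(* Main.v *)
(* The point sum_i t_i phi(x_i) lies between the least and the greatest of    *)
(* the phi(x_i). Either it equals one of these two values, or it is a proper   *)
(* convex combination of them; the definition of a phi-P-function bounds f     *)
(* there by two terms of the nonnegative sum. Induction on n would fail, since *)
(* partial convex combinations need not lie in the image of phi.              *)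

Require Import Defs.
From mathcomp Require Import all_boot all_order all_algebra.
From mathcomp Require Import reals.
From mathcomp Require Import ring.
Set Implicit Arguments.
Unset Strict Implicit.
Unset Printing Implicit Defensive.
Import Order.TTheory GRing.Theory Num.Theory.
Local Open Scope ring_scope.

(** The weighted mean is trapped between the extreme values [phi (x i)] and [phi (x j)]. At an
    extreme, [ler_term_sum] suffices; strictly between, [between_convex_comb] gives a weight for a
    single use of [f_phiP], and [ler_term2_sum] absorbs the two resulting terms. *)

Lemma between_convex_comb (R : realFieldType) (m M s : R) :
  m < s < M -> exists2 c : R, 0 < c < 1 & s = c * m + (1 - c) * M.
Proof.
move=> /andP[ms sM]; have mM := lt_trans ms sM.
have d0 : 0 < M - m by rewrite subr_gt0.
exists ((M - s) / (M - m)).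
  rewrite divr_gt0 ?subr_gt0 //= ltr_pdivrMr // mul1r.
  by rewrite ltrD2l ltrN2.
by field; rewrite gt_eqF.
Qed.

Lemma ler_term_sum (R : numDomainType) (I : finType) (F : I -> R) (i : I) :
  (forall j, 0 <= F j) -> F i <= \sum_j F j.
Proof. by move=> F0; rewrite (bigD1 i) //= lerDl sumr_ge0. Qed.

Lemma ler_term2_sum (R : numDomainType) (I : finType) (F : I -> R) (i j : I) :
  (forall k, 0 <= F k) -> i != j -> F i + F j <= \sum_k F k.
Proof.
move=> F0 ij; rewrite (bigD1 i) //= lerD2l (bigD1 j) /= 1?eq_sym //.
by rewrite lerDl sumr_ge0.
Qed.

Theorem theorem6 (R : realType) (a b : R) (phi f : R -> R)
    (phi_I : forall x : R, x \in `[a, b] -> phi x \in `[a, b])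
    (f_ge0 : forall x : R, x \in `[a, b] -> 0 <= f x)
    (f_phiP : phi_P_function `[a, b] phi f)
    (n : nat) (t x : 'I_n -> R)
    (t01 : forall i : 'I_n, 0 < t i < 1)
    (sum_t : \sum_(i < n) t i = 1)
    (x_I : forall i : 'I_n, x i \in `[a, b]) :
  f (\sum_(i < n) t i * phi (x i)) <= \sum_(i < n) f (phi (x i)).
Proof.
case: n t x t01 sum_t x_I => [|n] t x t01 sum_t x_I.
  (* No weights would sum to 0, not 1. *)
  by move/eqP: sum_t; rewrite big_ord0 eq_sym oner_eq0.
have t_ge0 i : 0 <= t i by case/andP: (t01 i) => /ltW.
have F0 i : 0 <= f (phi (x i)) by exact/f_ge0/phi_I/x_I.
case: (arg_minP (fun i => phi (x i)) (erefl : xpredT (ord0 : 'I_n.+1))) => i _ min_i.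
case: (arg_maxP (fun i => phi (x i)) (erefl : xpredT (ord0 : 'I_n.+1))) => j _ max_j.
set s := \sum_(k < n.+1) t k * phi (x k).
have le_s : phi (x i) <= s.
  (* The constant [phi (x i)] is its own [t]-weighted mean, so compare termwise. *)
  rewrite -[leLHS]mul1r -sum_t mulr_suml; apply: ler_sum => k _.
  by rewrite ler_wpM2l // min_i.
have s_le : s <= phi (x j).
  rewrite -[leRHS]mul1r -sum_t mulr_suml; apply: ler_sum => k _.
  by rewrite ler_wpM2l //; exact: max_j.
have [->|s_neq_i] := eqVneq s (phi (x i)).
  exact: (ler_term_sum (F := fun k => f (phi (x k)))).
have [->|s_neq_j] := eqVneq s (phi (x j)).
  exact: (ler_term_sum (F := fun k => f (phi (x k)))).
have lt_s : phi (x i) < s by rewrite lt_neqAle eq_sym s_neq_i.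
have s_lt : s < phi (x j) by rewrite lt_neqAle s_neq_j.
have [|c c01 ->] := @between_convex_comb _ (phi (x i)) (phi (x j)) s.
  by rewrite lt_s s_lt.
apply: (le_trans (f_phiP _ _ _ (x_I i) (x_I j) c01)).
apply: (ler_term2_sum (F := fun k => f (phi (x k)))) => //.
(* Strictness forces [i != j], so the two terms are distinct summands. *)
by apply: contraTneq (lt_trans lt_s s_lt) => ->; rewrite ltxx.
Qed.
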